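(* Let $R=R^\top>0$ in $\mathbb{R}^{m\times m}$ and put $R_o=R_T-R$. Let $P_o,Q_o\in\mathbb{R}^{n\times n}$ be symmetric matrices satisfying $$B^\top P_o+D^\top P_oC=(R_o+D^\top P_oD)(R_T+D^\top P_TD)^{-1}(B^\top P_T+D^\top P_TC)$$ and $$P_oA+A^\top P_o+C^\top P_oC+Q_o-K_T^\top(R_o+D^\top P_oD)K_T=0.$$ Set $P^*=P_T-P_o$ and $Q^*=Q_T-Q_o$, and suppose that $R+D^\top P^*D$ is invertible. Then $$P^*A+A^\top P^*+C^\top P^*C+Q^*-[P^*B+C^\top P^*D][R+D^\top P^*D]^{-1}[B^\top P^*+D^\top P^*C]=0$$ and $$K_T=-(R+D^\top P^*D)^{-1}(B^\top P^*+D^\top P^*C).$$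
   Context: $A,C\in\mathbb{R}^{n\times n}$ and $B,D\in\mathbb{R}^{n\times m}$ are constant matrices, and $W$ is a one-dimensional standard Brownian motion. It is assumed that the system is mean-square stabilizable, i.e. there is $K\in\mathbb{R}^{m\times n}$ such that for every initial value $x\in\mathbb{R}^n$ at time $t$ the solution of $dX(s)=(A+BK)X(s)\,ds+(C+DK)X(s)\,dW(s)$, $X(t)=x$, satisfies $\lim_{s\to\infty}\mathbb{E}[X(s)^\top X(s)]=0$. Target (expert) data: $Q_T=Q_T^\top>0$ in $\mathbb{R}^{n\times n}$ and $R_T=R_T^\top>0$ in $\mathbb{R}^{m\times m}$ are given; $P_T=P_T^\top>0$ is the unique positive definite solution of $$P_TA+A^\top P_T+C^\top P_TC+Q_T-[P_TB+C^\top P_TD][R_T+D^\top P_TD]^{-1}[B^\top P_T+D^\top P_TC]=0,$$ and the target gain matrix is $K_T=-(R_T+D^\top P_TD)^{-1}(B^\top P_T+D^\top P_TC)$. *)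

(* Defs.v *)
From HB Require Import structures.
From mathcomp Require Import all_boot all_order all_algebra.
From mathcomp Require Import all_classical all_reals all_analysis.

Set Implicit Arguments.
Unset Strict Implicit.
Unset Printing Implicit Defensive.

Import Order.TTheory GRing.Theory Num.Theory.
Import numFieldNormedType.Exports.

Local Open Scope classical_set_scope.
Local Open Scope ring_scope.

Section Brownian.
Context {d : measure_display} {Omega : measurableType d} {R : realType}.
Variables (P : probability Omega R) (W : R -> {RV P >-> R}).

(* Time is the half-line [0, +oo[: a process is a family indexed by R whose
   values at negative times are never used. *)

(* The filtration generated by W, augmented by the P-null events. *)
Definition brownian_filtration (s : R) : set (set Omega) :=
  <<s [set E | (exists (r : R) (U : set R),
                  [/\ 0 <= r <= s, measurable U & E = W r @^-1` U])
               \/ (measurable E /\ P E = 0%E)] >>.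

Definition increment (r s : R) (w : Omega) : R := W s w - W r w.

Definition rv_adapted (G : set (set Omega)) (Y : Omega -> R) : Prop :=
  forall U : set R, measurable U -> G (Y @^-1` U).

Record standard_brownian_motion : Prop := {
  bm_start : {ae P, forall w, W 0 w = 0};
  bm_continuous :
    {ae P, forall w, {within `[0, +oo[, continuous (fun r : R => W r w)}};
  (* the second parameter of [normal_prob] is the standard deviation *)
  bm_normal : forall r s : R, 0 <= r < s -> forall U : set R, measurable U ->
    P (increment r s @^-1` U) = normal_prob 0 (Num.sqrt (s - r)) U;
  bm_indep : forall r s : R, 0 <= r < s -> forall (E : set Omega) (U : set R),
    brownian_filtration r E -> measurable U ->
    P (E `&` (increment r s @^-1` U)) =
    (P E * P (increment r s @^-1` U))%E }.

(* Simple processes on [t, s]: sum over i < N of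
   sp_val i * 1_(]sp_time i, sp_time i.+1]). *)
Record simple_process (t s : R) := SimpleProcess {
  sp_size : nat;
  sp_time : nat -> R;
  sp_val : nat -> Omega -> R;
  sp_time_start : sp_time 0 = t;
  sp_time_end : sp_time sp_size = s;
  sp_time_mono : forall i j, (i <= j)%N -> sp_time i <= sp_time j;
  sp_val_adapted : forall i, (i < sp_size)%N ->
    rv_adapted (brownian_filtration (sp_time i)) (sp_val i);
  sp_val_bounded : forall i, (i < sp_size)%N ->
    exists M : R, forall w, `|sp_val i w| <= M }.

Definition sp_fun t s (Z : simple_process t s) (r : R) (w : Omega) : R :=
  \sum_(i < sp_size Z)
    sp_val Z i w * (sp_time Z i < r <= sp_time Z i.+1)%R%:R.

Definition sp_integral t s (Z : simple_process t s) (w : Omega) : R :=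
  \sum_(i < sp_size Z)
    sp_val Z i w * increment (sp_time Z i) (sp_time Z i.+1) w.

(* I is (a version of) the Ito integral of Y over [t, s] with respect to W:
   the L^2 limit of the integrals of simple processes converging to Y in
   L^2(P x dr).  Joint measurability of Y is not required here; it is automatic
   for the pathwise continuous integrands used below. *)
Definition is_ito_integral (t s : R) (Y : R -> Omega -> R) (I : Omega -> R) :
    Prop :=
  measurable_fun setT I /\
  exists Z : nat -> simple_process t s,
    (\int[P]_w \int[lebesgue_measure]_(r in `[t, s])
       ((Y r w - sp_fun (Z k) r w) ^+ 2)%:E)%E @[k --> \oo] --> 0%E /\
    (\int[P]_w ((I w - sp_integral (Z k) w) ^+ 2)%:E)%E @[k --> \oo] --> 0%E.

Variable n : nat.

(* X is a (strong, square-integrable) solution on [t, +oo[ of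
   dX(s) = F X(s) ds + G X(s) dW(s),  X(t) = x. *)
Record is_linear_sde_solution (F G : 'M[R]_n) (t : R) (x : 'cV[R]_n)
    (X : R -> Omega -> 'cV[R]_n) : Prop := {
  sol_adapted : forall s i, t <= s ->
    rv_adapted (brownian_filtration s) (fun w => X s w i 0);
  sol_continuous : forall w i,
    {within `[t, +oo[, continuous (fun s : R => X s w i 0)};
  sol_equation : forall s i, t <= s ->
    exists2 I : Omega -> R,
      is_ito_integral t s (fun r w => (G *m X r w) i 0) I &
      {ae P, forall w,
        X s w i 0 = x i 0
          + Rintegral lebesgue_measure `[t, s] (fun r => (F *m X r w) i 0)
          + I w} }.

Definition mean_square_stabilizable (m : nat)
    (A C : 'M[R]_n) (B D : 'M[R]_(n, m)) : Prop :=
  exists K : 'M[R]_(m, n),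
    forall (t : R) (x : 'cV[R]_n) (X : R -> Omega -> 'cV[R]_n),
      0 <= t ->
      is_linear_sde_solution (A + B *m K) (C + D *m K) t x X ->
      'E_P[fun w => (((X s w)^T *m X s w) 0 0)%R]%E @[s --> +oo] --> 0%E.

End Brownian.

Section Riccati.
Context {R : realType} {n m : nat}.

Definition posdefmx k (M : 'M[R]_k) : Prop :=
  M = M^T /\ forall v : 'cV[R]_k, v != 0 -> 0 < (v^T *m M *m v) 0 0.

Variables (A C : 'M[R]_n) (B D : 'M[R]_(n, m)).

Definition riccati_lhs (Q : 'M[R]_n) (Rw : 'M[R]_m) (P : 'M[R]_n) : 'M[R]_n :=
  P *m A + A^T *m P + C^T *m P *m C + Q
  - (P *m B + C^T *m P *m D) *m invmx (Rw + D^T *m P *m D)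
      *m (B^T *m P + D^T *m P *m C).

Definition feedback_gain (Rw : 'M[R]_m) (P : 'M[R]_n) : 'M[R]_(m, n) :=
  - (invmx (Rw + D^T *m P *m D) *m (B^T *m P + D^T *m P *m C)).

End Riccati.

(* Main.v *)
(* Write S(P) = R + D^T P D and N(P) = B^T P + D^T P C; both are affine in
   (R, P). The first condition on P_o says N_o = - S_o K_T, and N_T = - S_T K_T
   holds by definition of K_T, so subtracting gives N(P^* ) = - S(P^* ) K_T: the
   gain K_T is preserved. When N = - S K with S symmetric, the quadratic term of
   the Riccati equation is K^T S K, which is linear in S, so the equation for
   P^* is the difference of those for P_T and P_o. *)

Require Import Defs.
From HB Require Import structures.
From mathcomp Require Import all_boot all_order all_algebra.
From mathcomp Require Import all_classical all_reals all_analysis.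

Set Implicit Arguments.
Unset Strict Implicit.
Unset Printing Implicit Defensive.

Import Order.TTheory GRing.Theory Num.Theory.
Import numFieldNormedType.Exports.

Local Open Scope ring_scope.

(** A row v with v M = 0 gives v M v^T = 0, so definiteness at the column v^T forces v = 0. *)
Lemma posdefmx_unit (R : realType) k (M : 'M[R]_k) :
  posdefmx M -> M \in unitmx.
Proof.
case=> symM posM; rewrite -row_free_unit; apply: inj_row_free => v vM0.
apply/eqP; apply: contraT => v_neq0.
have := posM v^T; rewrite trmxK vM0 mul0mx mxE ltxx.
by rewrite -trmx0 (inj_eq (@trmx_inj _ _ _)) => /(_ v_neq0).
Qed.

Lemma posdefmx_ge0 (R : realType) k (M : 'M[R]_k) (v : 'cV[R]_k) :
  posdefmx M -> 0 <= (v^T *m M *m v) 0 0.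
Proof.
case=> _ posM; have [->|/posM/ltW//] := eqVneq v 0.
by rewrite mulmx0 mxE.
Qed.

Lemma trmx_congr (R : realType) n m (D : 'M[R]_(n, m)) (P : 'M[R]_n) :
  P = P^T -> (D^T *m P *m D)^T = D^T *m P *m D.
Proof. by move=> symP; rewrite !trmx_mul trmxK -symP mulmxA. Qed.

(** The congruence term is (D v)^T P (D v), only nonnegative since D v may vanish; strictness comes
    from [M]. *)
Lemma posdefmx_addl_congr (R : realType) n m (M : 'M[R]_m) (P : 'M[R]_n)
    (D : 'M[R]_(n, m)) :
  posdefmx M -> posdefmx P -> posdefmx (M + D^T *m P *m D).
Proof.
move=> posM posP; split=> [|v v_neq0].
  by rewrite linearD /= (trmx_congr _ (proj1 posP)) -(proj1 posM).
rewrite mulmxDr mulmxDl mxE ltr_pwDl ?(proj2 posM) //.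
by have := posdefmx_ge0 (D *m v) posP; rewrite trmx_mul !mulmxA.
Qed.

Lemma subr_add_subACA (V : zmodType) (a b c a' b' c' : V) :
  a - a' + (b - b') - (c - c') = (a + b - c) - (a' + b' - c').
Proof. by rewrite !opprD (addrACA a) (addrACA (a + b)). Qed.

Section RiccatiGain.
Context {R : realType} {n m : nat}.
Variables (A C : 'M[R]_n) (B D : 'M[R]_(n, m)) (Rw : 'M[R]_m) (P : 'M[R]_n).

Let S := Rw + D^T *m P *m D.
Let N := B^T *m P + D^T *m P *m C.

(** Trades the inverse in the gain for a relation without inverses, which can be subtracted between
    two Riccati data. *)
Lemma feedback_gain_eq (K : 'M[R]_(m, n)) : S \in unitmx ->
  (K = feedback_gain C B D Rw P) <-> (N = - (S *m K)).
Proof.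
move=> uS; rewrite /feedback_gain -/S -/N; split=> [->|->].
  by rewrite mulmxN opprK mulKVmx.
by rewrite mulmxN opprK mulKmx.
Qed.

(** Symmetry of [P] makes P B + C^T P D equal to N^T, so the quadratic term is N^T S^-1 N;
    substituting N = - S K, with S symmetric, cancels the inverse. *)
Lemma riccati_lhs_gain (Q : 'M[R]_n) (K : 'M[R]_(m, n)) :
  P = P^T -> Rw = Rw^T -> S \in unitmx -> N = - (S *m K) ->
  riccati_lhs A C B D Q Rw P =
  P *m A + A^T *m P + C^T *m P *m C + Q - K^T *m S *m K.
Proof.
move=> symP symR uS defN.
have symS : S^T = S by rewrite linearD /= trmx_congr // -symR.
have -> : K^T *m S *m K = N^T *m invmx S *m N.
  rewrite defN [(- _)^T]linearN /= trmx_mul symS mulNmx mulmxN mulNmx opprK.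
  by rewrite -!mulmxA mulKmx.
by rewrite [(_ + _)^T]linearD /= !trmx_mul !trmxK -symP mulmxA.
Qed.

End RiccatiGain.

Theorem theorem3p5 (R : realType)
    (d : measure_display) (Omega : measurableType d)
    (Pr : probability Omega R) (W : R -> {RV Pr >-> R})
    (hW : standard_brownian_motion W)
    (n m : nat) (A C : 'M[R]_n) (B D : 'M[R]_(n, m))
    (hstab : mean_square_stabilizable W A C B D)
    (Q_T : 'M[R]_n) (R_T : 'M[R]_m)
    (hQ_T : posdefmx Q_T) (hR_T : posdefmx R_T)
    (P_T : 'M[R]_n) (hP_T : posdefmx P_T)
    (hP_T_eq : riccati_lhs A C B D Q_T R_T P_T = 0)
    (hP_T_uniq : forall P : 'M[R]_n, posdefmx P ->
       riccati_lhs A C B D Q_T R_T P = 0 -> P = P_T)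
    (Rw : 'M[R]_m) (hRw : posdefmx Rw)
    (P_o Q_o : 'M[R]_n) (hP_o : P_o = P_o^T) (hQ_o : Q_o = Q_o^T) :
  let K_T := feedback_gain C B D R_T P_T in
  let R_o := R_T - Rw in
  B^T *m P_o + D^T *m P_o *m C =
    (R_o + D^T *m P_o *m D) *m invmx (R_T + D^T *m P_T *m D)
      *m (B^T *m P_T + D^T *m P_T *m C) ->
  P_o *m A + A^T *m P_o + C^T *m P_o *m C + Q_o
    - K_T^T *m (R_o + D^T *m P_o *m D) *m K_T = 0 ->
  let P_s := P_T - P_o in
  let Q_s := Q_T - Q_o in
  Rw + D^T *m P_s *m D \in unitmx ->
  riccati_lhs A C B D Q_s Rw P_s = 0 /\
  K_T = feedback_gain C B D Rw P_s.
Proof.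
move=> K_T R_o defN_o eq_o P_s Q_s uS_s.
have posS_T := posdefmx_addl_congr D hR_T hP_T.
have uS_T := posdefmx_unit posS_T.
have defN_T := (feedback_gain_eq C B K_T uS_T).1 erefl.
have {}defN_o : B^T *m P_o + D^T *m P_o *m C =
    - ((R_o + D^T *m P_o *m D) *m K_T).
  by rewrite defN_o /K_T /feedback_gain mulmxN opprK mulmxA.
(* Holds because [Rw] = [R_T] - [R_o]. *)
have defS_s : Rw + D^T *m P_s *m D =
    (R_T + D^T *m P_T *m D) - (R_o + D^T *m P_o *m D).
  by rewrite mulmxBr mulmxBl opprD addrACA opprB addrC subrKC addrC.
have defN_s : B^T *m P_s + D^T *m P_s *m C =
    - ((Rw + D^T *m P_s *m D) *m K_T).
  rewrite defS_s mulmxBl opprB !(mulmxBr, mulmxBl) addrACA -opprD.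
  by rewrite defN_T defN_o opprK addrC.
(* [P_s] may fail to be positive definite, so [uS_s] supplies the inverse here. *)
split; last exact/feedback_gain_eq.
have symP_s : P_s = P_s^T by rewrite linearB /= -hP_o -(proj1 hP_T).
rewrite (riccati_lhs_gain _ _ symP_s (proj1 hRw) uS_s defN_s).
have := hP_T_eq.
rewrite (riccati_lhs_gain _ _ (proj1 hP_T) (proj1 hR_T) uS_T defN_T) => eq_T.
(* The right-hand 0 becomes 0 - 0, and each 0 is then expanded into the left side of the equation
   for [P_T] or [P_o]. *)
rewrite -[RHS](subrr 0) -[X in _ = X - _]eq_T -[X in _ = _ - X]eq_o.
have -> : P_s *m A + A^T *m P_s + C^T *m P_s *m C =
    (P_T *m A + A^T *m P_T + C^T *m P_T *m C) -
    (P_o *m A + A^T *m P_o + C^T *m P_o *m C).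
  by rewrite !(mulmxBr, mulmxBl) !opprD (addrACA (P_T *m A)) [LHS]addrACA.
by rewrite defS_s mulmxBr mulmxBl subr_add_subACA.
Qed.
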